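(* There is an algorithm which, given any one-dimensional peg solitaire configuration $w\in\{0,1\}^n$, outputs in time $O(n)$ a sequence of legal moves reducing $w$ to a configuration whose number of pegs is the minimum number of pegs to which $w$ can be reduced by any sequence of legal moves.
   Context: One-dimensional peg solitaire: a configuration is a finite word over $\{0,1\}$, where $1$ denotes a peg and $0$ a hole; the board consists of the positions of the word only. A move consists of a peg hopping over an adjacent peg into the hole immediately beyond it, the jumped-over peg being removed: i.e. a factor $110$ at three consecutive positions is replaced by $001$, or a factor $011$ is replaced by $100$. *)

(* Defs.v *)
From mathcomp Require Import all_boot.
Set Implicit Arguments.
Unset Strict Implicit.
Unset Printing Implicit Defensive.

(** * One-dimensional peg solitaire *)

(** [true] is a peg and [false] a hole. *)
Definition word := seq bool.

Definition pegs (w : word) : nat := count id w.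

(** [hop (i, j) w w'] : the peg at position [i] of [w] (counted from [0]) hops
    into position [j], which yields [w']. *)
Inductive hop : nat * nat -> word -> word -> Prop :=
| hop_right (u v : word) :
    hop (size u, (size u).+2)
        (u ++ [:: true; true; false] ++ v)
        (u ++ [:: false; false; true] ++ v)
| hop_left (u v : word) :
    hop ((size u).+2, size u)
        (u ++ [:: false; true; true] ++ v)
        (u ++ [:: true; false; false] ++ v).

Inductive play : seq (nat * nat) -> word -> word -> Prop :=
| play_nil (w : word) : play [::] w w
| play_cons m ms (w w1 w2 : word) :
    hop m w w1 -> play ms w1 w2 -> play (m :: ms) w w2.

(** * Algorithms and their running time *)

(** Algorithms are programs of a unit-cost random access machine, written with
    structured control flow.  A program is a finite text, so it uses finitely
    many registers and arrays, chosen independently of the input.  The only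
    arithmetic is the successor and the predecessor: after [t] steps on an
    input of length [n] no stored number exceeds [n + t + c], where [c] is the
    largest constant of the program.  A linear-time computation thus only
    handles words of [O(log n)] bits, and charging one unit for each elementary
    operation is realistic. *)

Definition reg := nat.
Definition arr := nat.

Inductive test :=
| Eq of reg & reg
| Lt of reg & reg.

Inductive cmd :=
| Skip
| Const of reg & nat          (* x := k *)
| Copy of reg & reg          (* x := y *)
| Inc of reg                 (* x := x + 1 *)
| Dec of reg                 (* x := x - 1, truncated at 0 *)
| Read of reg & arr & reg    (* x := a[y] *)
| Write of arr & reg & reg   (* a[y] := x *)
| Seq of cmd & cmd
| If of test & cmd & cmd
| While of test & cmd.

Record state := State { regs : reg -> nat; mem : arr -> nat -> nat }.

Definition set_reg (s : state) (x : reg) (v : nat) : state :=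
  State (fun y => if y == x then v else regs s y) (mem s).

Definition set_mem (s : state) (a : arr) (i v : nat) : state :=
  State (regs s)
        (fun b j => if (b == a) && (j == i) then v else mem s b j).

Definition eval (b : test) (s : state) : bool :=
  match b with
  | Eq x y => regs s x == regs s y
  | Lt x y => regs s x < regs s y
  end.

(** [exec c s t s'] : started in state [s], the program [c] halts in state [s']
    after exactly [t] steps, a step being the execution of an elementary
    instruction or the evaluation of a test. *)
Inductive exec : cmd -> state -> nat -> state -> Prop :=
| exec_skip s : exec Skip s 1 s
| exec_const s x k : exec (Const x k) s 1 (set_reg s x k)
| exec_copy s x y : exec (Copy x y) s 1 (set_reg s x (regs s y))
| exec_inc s x : exec (Inc x) s 1 (set_reg s x (regs s x).+1)
| exec_dec s x : exec (Dec x) s 1 (set_reg s x (regs s x).-1)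
| exec_read s x a y :
    exec (Read x a y) s 1 (set_reg s x (mem s a (regs s y)))
| exec_write s a y x :
    exec (Write a y x) s 1 (set_mem s a (regs s y) (regs s x))
| exec_seq c1 c2 s s1 s2 t1 t2 :
    exec c1 s t1 s1 -> exec c2 s1 t2 s2 -> exec (Seq c1 c2) s (t1 + t2) s2
| exec_if b c1 c2 s s1 t :
    exec (if eval b s then c1 else c2) s t s1 -> exec (If b c1 c2) s t.+1 s1
| exec_while_done b c s : ~~ eval b s -> exec (While b c) s 1 s
| exec_while_loop b c s s1 s2 t1 t2 :
    eval b s -> exec c s t1 s1 -> exec (While b c) s1 t2 s2 ->
    exec (While b c) s (t1 + t2).+1 s2.

(** A program has at most one halting run from a given state. *)
Lemma exec_det c s t1 s1 t2 s2 :
  exec c s t1 s1 -> exec c s t2 s2 -> t1 = t2 /\ s1 = s2.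
Proof.
move=> h; elim: h t2 s2 => {c s t1 s1}.
- by move=> s t2 s2 h; inversion h.
- by move=> s x k t2 s2 h; inversion h.
- by move=> s x y t2 s2 h; inversion h.
- by move=> s x t2 s2 h; inversion h.
- by move=> s x t2 s2 h; inversion h.
- by move=> s x a y t2 s2 h; inversion h.
- by move=> s a y x t2 s2 h; inversion h.
- move=> c1 c2 s s1 s2 t1 t2 _ IH1 _ IH2 t3 s3 h.
  inversion h as [| | | | | | |? ? ? ? ? ? ? h1 h2| | |]; subst.
  by have [? ?] := IH1 _ _ h1; subst; have [-> ->] := IH2 _ _ h2.
- move=> b c1 c2 s s1 t _ IH t3 s3 h.
  inversion h as [| | | | | | | |? ? ? ? ? ? h1| |]; subst.
  by have [-> ->] := IH _ _ h1.
- move=> b c s nb t3 s3 h.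
  inversion h as [| | | | | | | | |? ? ? h1|? ? ? ? ? ? ? h1]; subst=> //.
  by rewrite h1 in nb.
- move=> b c s s1 s2 t1 t2 eb _ IH1 _ IH2 t3 s3 h.
  inversion h as [| | | | | | | | |? ? ? h1|? ? ? ? ? ? ? h1 h2 h3]; subst.
    by rewrite eb in h1.
  by have [? ?] := IH1 _ _ h2; subst; have [-> ->] := IH2 _ _ h3.
Qed.

(** Input convention: register [0] holds the length of [w], array [0] holds its
    letters ([1] for a peg), and all other storage is initially [0]. *)
Definition input (w : word) : state :=
  State (fun x => if x == 0 then size w else 0)
        (fun a i => if a == 0 then nat_of_bool (nth false w i) else 0).

(** Output convention: register [1] holds the number of moves, and the [k]-th
    move goes from position [a1[k]] to position [a2[k]], where [a1] and [a2] are
    the arrays numbered [1] and [2]. *)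
Definition output (s : state) : seq (nat * nat) :=
  mkseq (fun k => (mem s 1 k, mem s 2 k)) (regs s 1).

(* Main.v *)
Require Import Defs.
From mathcomp Require Import all_boot zify.
Set Implicit Arguments.
Unset Strict Implicit.
Unset Printing Implicit Defensive.

(** The pegs that end up as one peg form a contiguous group.  Apart from single
    pegs and pairs, the groups that can be reduced to one peg form a regular
    language and need no cell outside the group; a pair needs one more cell, which
    is a hole or is vacated by a neighbouring group.  Hence the minimum number of
    pegs is the least cost of a path in a finite automaton whose paths split the
    word into groups.

    That it is a lower bound amounts to a hop never decreasing the least cost:
    every path over the word after the hop is matched by one over the word before
    it that is not dearer, which is a finite subset simulation.  That it is
    attained follows by local rewriting: a window of a path is reducible if a hop
    inside it can be made and the path rerouted between the same two states without
    raising its cost.  A finite check shows that a path without reducible windows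
    costs as much as there are pegs.  A cheapest path is found in linear time by
    dynamic programming.  A cursor then sweeps the path, going three cells back
    after each hop, so that [4 * pegs + (n + 1 - cursor)] decreases. *)

(** * The automaton *)

(** [free]: the last cell read is a hole, or is vacated by the group on its
    left, and is available to the next pair; [stuck]: it is not available;
    [needy]: a pair has been read that must hop to the right, so that the next
    cell must be a hole or belong to a group that vacates it. *)
Definition free := 0.
Definition stuck := 1.
Definition needy := 2.
Definition final := 20.
Definition nstates := 21.

(** Row [p] lists the successors of state [p] on the letters 0, 1 and the end
    marker 2.  With [H = 11(01)^*], [Y = (10)^*11] and [T = (11)^*Y], the groups
    of at least three pegs that reduce to a single peg are [10T], [H00T],
    [H1101T], [H(11)^*01], [H(11)^+00Y] and [H(11)^*1011Y].  The states [x], [k],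
    [t], [y] stand after [H], after [H(11)^+], before [T] and before [Y]; [lp]
    and [rp] are in the middle of a pair that hops to the left or right. *)
Definition table : seq (seq (seq nat)) :=
  let lp := 3 in let rp := 4 in
  let h := 5 in let x := 6 in let x0 := 7 in
  let k1 := 8 in let k := 9 in let k0 := 10 in
  let c0 := 11 in let c1 := 12 in
  let d1 := 13 in let d2 := 14 in let d3 := 15 in
  let t := 16 in let t1 := 17 in let y := 18 in let y1 := 19 in
  [:: [:: [:: free]; [:: stuck; lp; rp; h]; [:: final]];
      [:: [:: free]; [:: stuck; rp; h]; [:: final]];
      [:: [:: stuck]; [:: rp; h]];
      [:: [::]; [:: free]];
      [:: [::]; [:: needy]];
      [:: [:: t]; [:: x]];
      [:: [:: x0]; [:: k1; d1]];
      [:: [:: t]; [:: x; free]];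
      [:: [:: c0]; [:: k]];
      [:: [:: k0]; [:: k1]];
      [:: [:: y]; [:: free]];
      [:: [::]; [:: c1]];
      [:: [::]; [:: y]];
      [:: [::]; [:: d2]];
      [:: [:: d3]];
      [:: [::]; [:: t]];
      [:: [::]; [:: t1; y1]];
      [:: [::]; [:: t]];
      [:: [::]; [:: y1]];
      [:: [:: y]; [:: free]]].

Definition delta (p a : nat) : seq nat := nth [::] (nth [::] table p) a.

(** Every group pays 1 for its first peg; the states up to [needy] are the ones
    between two groups. *)
Definition cost (p a : nat) : nat := (p <= needy) && (a == 1).

Definition tape (w : word) : seq nat := map nat_of_bool w ++ [:: 2].

Inductive reach : nat -> seq nat -> nat -> Prop :=
| reach_final : reach final [::] 0
| reach_step p a l q c :
    q \in delta p a -> reach q l c -> reach p (a :: l) (cost p a + c).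

Lemma reach_inv p a l c : reach p (a :: l) c ->
  exists q c', [/\ q \in delta p a, reach q l c' & c = cost p a + c'].
Proof. by move=> h; inversion h; subst; exists q, c0. Qed.

Lemma delta_lt p a q : q \in delta p a -> q < nstates.
Proof.
move: p a; have /allP h : all (all (all (fun q => q < nstates))) table by [].
move=> p a; rewrite /delta.
case: (ltnP p (size table)) => hp; last by rewrite (nth_default _ hp) nth_nil.
have /allP h1 := h _ (mem_nth [::] hp).
case: (ltnP a (size (nth [::] table p))) => ha; last by rewrite nth_default.
have /allP h2 := h1 _ (mem_nth [::] ha).
exact: h2.
Qed.

(** Every peg may form a group of its own, so the least cost never exceeds the number of pegs. *)
Lemma reach_singles p w : p <= 1 -> reach p (tape w) (pegs w).
Proof.
elim: w p => [|b w IH] p hp.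
  have -> : pegs [::] = cost p 2 + 0 by rewrite /cost andbF.
  by apply: (reach_step _ reach_final); case: p hp => [|[|p]].
rewrite /tape /= -/(tape w).
have -> : b + pegs w = cost p b + pegs w.
  by rewrite /cost (leq_trans hp) //=; case: b.
apply: (@reach_step _ _ _ (if b then stuck else free)).
  by case: p hp b => [|[|p]] // _ [].
by apply: IH; case: b.
Qed.

(** * A hop does not decrease the least cost *)

(** The configuration [(p, V)] asserts that each state of [V] is reached, on the
    word before the hop, no more expensively than [p] on the word after it. *)
Definition cfg := (nat * seq nat)%type.

(** An [if], since [&&] evaluates both operands under [vm_compute]. *)
Definition below (x y : cfg) : bool := if x.1 == y.1 then all (mem y.2) x.2 else false.

(** Savings are discarded: a step must be no dearer than the one it matches. Configurations thus
    carry no cost differences, and only finitely many arise. *)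
Definition lift (V : seq nat) (a c : nat) : seq nat :=
  undup (flatten [seq delta r a | r <- V & cost r a <= c]).

Definition succs (x : cfg) : seq cfg :=
  flatten [seq [seq (q, lift x.2 a (cost x.1 a)) | q <- delta x.1 a]
          | a <- [:: 0; 1; 2]].

Fixpoint lpaths (p : nat) (l : seq nat) : seq (nat * nat) :=
  match l with
  | [::] => [:: (p, 0)]
  | a :: l' =>
      flatten [seq [seq (x.1, cost p a + x.2) | x <- lpaths q l'] | q <- delta p a]
  end.

Definition hops3 : seq (seq nat * seq nat) :=
  [:: ([:: 1; 1; 0], [:: 0; 0; 1]); ([:: 0; 1; 1], [:: 1; 0; 0])].

(** The three letters of a hop are consumed at once: costs are compared over the whole hop, not
    letter by letter. *)
Definition hop_succs (x : cfg) : seq cfg :=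
  flatten [seq [seq (qc.1, undup [seq rc.1 | rc <- flatten [seq lpaths r h.1 | r <- x.2]
                                       & rc.2 <= qc.2])
              | qc <- lpaths x.1 h.2] | h <- hops3].

(** A worklist search that keeps only configurations minimal for [below], since a smaller set of
    states is a stronger assertion. Its result is checked afterwards by [maps_to]. *)
Fixpoint saturate (fuel : nat) (todo tab : seq cfg) : seq cfg :=
  match fuel, todo with
  | n.+1, x :: todo' =>
      if has (below^~ x) tab then saturate n todo' tab
      else saturate n (succs x ++ todo')
                    (x :: [seq y <- tab | ~~ below x y])
  | _, _ => tab
  end.
Definition maps_to (f : cfg -> seq cfg) (s t : seq cfg) : bool :=
  all (fun x => all (fun y => has (below^~ y) t) (f x)) s.

(** [s] covers the configurations met on the common prefix, [t] those met after the hop. Both sides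
    start in [stuck], as no cell lies to the left of the board. *)
Lemma simulation : exists s t : seq cfg,
  [/\ maps_to succs s s, maps_to hop_succs s t, maps_to succs t t,
      has (below^~ (stuck, [:: stuck])) s
    & all (fun x => (x.1 == final) ==> (final \in x.2)) t].
Proof.
pose s := saturate 1000 [:: (stuck, [:: stuck])] [::].
pose t := saturate 1000 (flatten (map hop_succs s)) [::].
by exists s, t; vm_compute.
Qed.

Lemma maps_toP f s t x y : maps_to f s t -> x \in s -> y \in f x ->
  exists z, [/\ z \in t, z.1 = y.1 & {subset z.2 <= y.2}].
Proof.
move=> /allP h /h /allP {}h /h /hasP [z zt]; rewrite /below.
by case: eqP => // e /allP sub; exists z; split=> // q /sub.
Qed.

Lemma delta_letter p a q : q \in delta p a -> a \in [:: 0; 1; 2].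
Proof.
have /allP h : all (fun s => size s <= 3) table by [].
rewrite /delta; case: (ltnP p (size table)) => hp; last first.
  by rewrite (nth_default _ hp) nth_nil.
have := h _ (mem_nth [::] hp); case: (ltnP a 3) => [|ha hs].
  by case: a => [|[|[|]]].
by rewrite nth_default // (leq_trans hs).
Qed.

Lemma succs_mem x a q :
  q \in delta x.1 a -> (q, lift x.2 a (cost x.1 a)) \in succs x.
Proof.
move=> hq; apply/flattenP.
exists [seq (q, lift x.2 a (cost x.1 a)) | q <- delta x.1 a].
  by apply: (map_f (fun a => [seq (q, lift x.2 a (cost x.1 a)) | q <- delta x.1 a]));
     apply: delta_letter hq.
exact: (map_f (fun q => (q, lift x.2 a (cost x.1 a)))).
Qed.

Lemma lift_reach V a c q l d : q \in lift V a c -> reach q l d ->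
  exists r, [/\ r \in V, cost r a <= c & reach r (a :: l) (cost r a + d)].
Proof.
rewrite mem_undup => /flattenP [s /mapP [r]]; rewrite mem_filter.
by case/andP=> rc rV -> hq hr; exists r; split=> //; apply: reach_step hr.
Qed.

Lemma sim_step s t x a p l c :
  maps_to succs s t -> x \in s -> p \in delta x.1 a ->
  (forall z, z \in t -> z.1 = p ->
     exists r d, [/\ r \in z.2, reach r l d & d <= c]) ->
  exists r d, [/\ r \in x.2, reach r (a :: l) d & d <= cost x.1 a + c].
Proof.
move=> st xs px h; have [z [zt e sub]] := maps_toP st xs (succs_mem px).
have [q [d [/sub qz hq dc]]] := h z zt e.
have [r [rx rc hr]] := lift_reach qz hq.
by exists r, (cost r a + d); split=> //; apply: leq_add.
Qed.

Lemma sim_reach t x l c : maps_to succs t t ->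
  all (fun x => (x.1 == final) ==> (final \in x.2)) t ->
  x \in t -> reach x.1 l c ->
  exists r d, [/\ r \in x.2, reach r l d & d <= c].
Proof.
move=> cl /allP fin; move e: x.1 => p xs h; elim: h x e xs => {p l c} [|p a l q c pq _ IH] x e xs.
  exists final, 0; split=> //; last exact: reach_final.
  by have := fin _ xs; rewrite e eqxx.
rewrite -e; rewrite -e in pq.
by apply: (sim_step cl xs pq) => z zt ze; apply: IH.
Qed.

Lemma lpaths_reach p l q c v d :
  (q, c) \in lpaths p l -> reach q v d -> reach p (l ++ v) (c + d).
Proof.
elim: l p q c => [|a l IH] p q c /=; first by rewrite inE => /eqP [-> ->].
case/flattenP=> s /mapP [r rp ->] /mapP [[q' c'] h [-> ->]] /= hv.
by rewrite -addnA; apply: (reach_step rp); apply: IH hv.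
Qed.

Lemma reach_lpaths p l v c : reach p (l ++ v) c ->
  exists q d e, [/\ (q, d) \in lpaths p l, reach q v e & c = d + e].
Proof.
elim: l p c => [|a l IH] p c /=.
  by exists p, 0, c; rewrite inE.
case/reach_inv => q [c' [qp /IH [r [d [e [h hv ->]]]] ->]].
exists r, (cost p a + d), e; split=> //; last by rewrite addnA.
apply/flattenP; exists [seq (x.1, cost p a + x.2) | x <- lpaths q l].
  exact: (map_f (fun q => [seq (x.1, cost p a + x.2) | x <- lpaths q l])).
exact: (map_f (fun x => (x.1, cost p a + x.2)) h).
Qed.

(** The common prefix is simulated within [s], the hop leads from [s] to [t], and the common suffix
    stays in [t]. *)
Lemma sim_hop_reach s t x u h v c :
  maps_to succs s s -> maps_to hop_succs s t -> maps_to succs t t ->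
  all (fun x => (x.1 == final) ==> (final \in x.2)) t ->
  h \in hops3 -> x \in s -> reach x.1 (u ++ h.2 ++ v) c ->
  exists r d, [/\ r \in x.2, reach r (u ++ h.1 ++ v) d & d <= c].
Proof.
move=> cl hcl tcl fin hh; elim: u x c => [|a u IH] x c xs.
  rewrite !cat0s => /reach_lpaths [q [d [e [qd hv ->]]]].
  pose V := undup [seq rc.1 | rc <- flatten [seq lpaths r h.1 | r <- x.2]
                           & rc.2 <= d].
  have hx : (q, V) \in hop_succs x.
    apply/flattenP; eexists; first by apply/mapP; exists h.
    by apply/mapP; exists (q, d).
  have [z [zt ze sub]] := maps_toP hcl xs hx.
  rewrite -[q]/(q, V).1 -ze in hv.
  have [r [d' [/sub]]] := sim_reach tcl fin zt hv.
  rewrite mem_undup => /mapP [[r' c']]; rewrite mem_filter /=.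
  case/andP=> c'd /flattenP [? /mapP [p px ->]] hp -> hr d'e.
  exists p, (c' + d'); split; [by [] | exact: lpaths_reach hp hr | exact: leq_add].
case/reach_inv => q [c' [qp hq ->]].
apply: (sim_step cl xs qp) => z zs ze; apply: IH => //.
by rewrite ze.
Qed.

Lemma hop_split m w w1 : hop m w w1 -> exists u h v,
  [/\ h \in hops3, tape w = u ++ h.1 ++ v & tape w1 = u ++ h.2 ++ v].
Proof.
case=> u v.
  exists (map nat_of_bool u), ([:: 1; 1; 0], [:: 0; 0; 1]), (tape v).
  by rewrite /tape !map_cat -!catA.
exists (map nat_of_bool u), ([:: 0; 1; 1], [:: 1; 0; 0]), (tape v).
by rewrite /tape !map_cat -!catA.
Qed.

Lemma hop_reach m w w1 c : hop m w w1 -> reach stuck (tape w1) c ->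
  exists2 d, reach stuck (tape w) d & d <= c.
Proof.
case/hop_split=> u [h [v [hh -> ->]]] hr.
have [s [t [scl hcl tcl /hasP [z zs zb] fin]]] := simulation; move: zb; rewrite /below /=.
case: eqP => // ze /allP sub; rewrite -ze in hr.
have [r [d [/sub]]] := sim_hop_reach scl hcl tcl fin hh zs hr.
by rewrite /= mem_seq1 => /eqP -> hd dc; exists d.
Qed.

(** The lower bound: single pegs give a path over the last word, and [hop_reach] carries it back
    through the play without raising its cost. *)
Lemma play_reach ms w w1 : play ms w w1 ->
  exists2 d, reach stuck (tape w) d & d <= pegs w1.
Proof.
elim=> [{}w|m {}ms {}w w2 w3 hm _ [d hd dc]].
  by exists (pegs w) => //; apply: reach_singles.
by have [e he ed] := hop_reach hm hd; exists e => //; apply: leq_trans dc.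
Qed.

(** * Rewriting cheapest paths *)

Fixpoint spaths (p : nat) (l : seq nat) : seq (seq nat) :=
  match l with
  | [::] => [:: [::]]
  | a :: l' => flatten [seq [seq q :: s | s <- spaths q l'] | q <- delta p a]
  end.

Fixpoint pcost (p : nat) (l s : seq nat) : nat :=
  match l, s with
  | a :: l', q :: s' => cost p a + pcost q l' s'
  | _, _ => 0
  end.

(** The hops inside a window of four letters; four letters suffice for the path
    to be rerouted, and a window may contain the end marker. *)
Definition hops4 (l : seq nat) : seq (nat * nat * seq nat) :=
  flatten [seq [seq (if head 0 h.1 == 1 then (k, k.+2) else (k.+2, k),
                     take k l ++ h.2 ++ drop k.+3 l)
               | h <- hops3 & take 3 (drop k l) == h.1] | k <- [:: 0; 1]].

(** Each pair is a state and the letter read from it. *)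
Definition frag := seq (nat * nat).

Definition rewrites (f : frag) (q : nat) : seq (nat * nat * seq nat * seq nat) :=
  let p := (head (0, 0) f).1 in
  let l := map snd f in
  let c := sumn [seq cost x.1 x.2 | x <- f] in
  flatten [seq [seq (h, s) | s <- spaths p h.2 & (last p s == q) && (pcost p h.2 s <= c)]
          | h <- hops4 l].

Definition node := (frag * nat)%type.

Definition push (f : frag) (x : nat * nat) : frag :=
  if size f < 3 then rcons f x else behead (rcons f x).

Definition ok (f : frag) (x : nat * nat) (q : nat) : bool :=
  (size f < 3) || nilp (rewrites (rcons f x) q).

Definition expand (x : node) : seq (nat * node) :=
  flatten [seq [seq (a, (push x.1 (x.2, a), q)) | q <- delta x.2 a & ok x.1 (x.2, a) q]
          | a <- [:: 0; 1; 2]].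

Fixpoint explore (fuel : nat) (todo seen : seq node) : seq node :=
  match fuel, todo with
  | n.+1, x :: todo' =>
      if x \in seen then explore n todo' seen
      else explore n (map snd (expand x) ++ todo') (x :: seen)
  | _, _ => seen
  end.

(** [s] contains the irreducible path fragments, as the last three steps and the
    current state, and [g] those from which [final] can still be reached. *)
Lemma irreducible_paths : exists s g : seq node,
  [/\ ([::], stuck) \in s,
      all (fun x => all (fun y => y.2 \in s) (expand x)) s,
      all (fun x => (x.2 == final) ==> (x \in g)) s
    & all (fun x => all (fun y => (y.2 \in g) ==>
             (x \in g) && (cost x.2 y.1 == (y.1 == 1))) (expand x)) s].
Proof.
pose s := explore 1000 [:: ([::], stuck)] [::].
(* Backward reachability from [final]; the last conjunct confirms that 20 rounds reach a fixed
   point. *)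
pose g := iter 20 (fun g => [seq x <- s | (x \in g) || has (mem g) (map snd (expand x))])
               [seq x <- s | x.2 == final].
by exists s, g; vm_compute.
Qed.

Definition window (A q : nat -> nat) (i : nat) : frag :=
  [seq (q k, A k) | k <- iota i 4].

(** Reading forwards keeps the path in [s]; going backwards from [final] then keeps it in [g], where
    a step costs 1 exactly when it reads a peg. *)
Lemma irreducible_cost A q N :
  q 0 = stuck -> q N = final ->
  (forall j, j < N -> q j.+1 \in delta (q j) (A j)) ->
  (forall i, i + 4 <= N -> rewrites (window A q i) (q (i + 4)) = [::]) ->
  forall j, j < N -> cost (q j) (A j) = (A j == 1).
Proof.
move=> q0 qN path irr.
(* For [j < 3] the truncated [j - 3] is 0, and the fragment is the whole path so far. *)
pose fr j := [seq (q k, A k) | k <- iota (j - 3) (minn j 3)].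
have size_fr j : size (fr j) = minn j 3 by rewrite size_map size_iota.
have frS j : fr j.+1 = push (fr j) (q j, A j).
  rewrite /push size_fr; case: j => [|[|[|j]]] //.
  by rewrite /fr !subSS !subn0 !minnSS.
have okj j : j < N -> ok (fr j) (q j, A j) (q j.+1).
  move=> hj; rewrite /ok size_fr; case: (ltnP j 3) => j3.
    by rewrite j3.
  have -> : rcons (fr j) (q j, A j) = window A q (j - 3).
    rewrite /fr (minn_idPr j3); move: (j - 3) (subnK j3) => k <-.
    by rewrite /window /= !addnS addn0.
  by rewrite -{2}(subnK j3) -addnS irr ?orbT //; lia.
have [s [g [s0 cl fin liv]]] := irreducible_paths.
have hexp j : j < N -> (A j, (fr j.+1, q j.+1)) \in expand (fr j, q j).
  move=> hj; apply/flattenP; eexists.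
    by apply/mapP; exists (A j) => //; apply: delta_letter (path j hj).
  apply/mapP; exists (q j.+1); last by rewrite frS.
  by rewrite mem_filter okj //= path.
have ins j : j <= N -> (fr j, q j) \in s.
  elim: j => [|j IH] hj; first by rewrite q0.
  have /allP/(_ _ (IH (ltnW hj))) /allP h := cl.
  exact: h (hexp _ hj).
have step j : j < N -> (fr j.+1, q j.+1) \in g ->
    (fr j, q j) \in g /\ cost (q j) (A j) = (A j == 1).
  move=> hj hg; have /allP/(_ _ (ins _ (ltnW hj))) /allP h := liv.
  by have /implyP/(_ hg) /andP [? /eqP] := h _ (hexp _ hj).
have ing k : k <= N -> (fr (N - k), q (N - k)) \in g.
  elim: k => [|k IH] hk.
    have /allP/(_ _ (ins _ (leqnn N))) /= := fin.
    by rewrite subn0 qN eqxx.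
  have /step [|//] : N - k.+1 < N by lia.
  by rewrite -subSn // subSS IH // ltnW.
move=> j hj; have /step [|//] := hj.
by have := ing (N - j.+1); rewrite subKn // leq_subr => ->.
Qed.

(** * Carrying out a rewrite on the board and on the path *)

Lemma big_window (F G : nat -> nat) i N : i + 4 <= N ->
  (forall j, j < i \/ i + 4 <= j -> F j = G j) ->
  \sum_(0 <= j < N) F j + (G i + G i.+1 + G i.+2 + G i.+3) =
  \sum_(0 <= j < N) G j + (F i + F i.+1 + F i.+2 + F i.+3).
Proof.
move=> iN FG.
have split (H : nat -> nat) : \sum_(0 <= j < N) H j = \sum_(0 <= j < i) H j +
    (H i + H i.+1 + H i.+2 + H i.+3) + \sum_(i + 4 <= j < N) H j.
  rewrite (big_cat_nat (n := i + 4)) //= (big_cat_nat (n := i)) ?leq_addr //=.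
  congr (_ + _ + _); rewrite -{1}[i]add0n [i + 4]addnC big_addn addnK.
  by rewrite !big_nat_recr //= big_nil /= !addSn !add0n.
rewrite (split F) (split G) {split}.
have -> : \sum_(0 <= j < i) F j = \sum_(0 <= j < i) G j.
  by apply: eq_big_nat => j hj; apply: FG; left; lia.
have -> : \sum_(i + 4 <= j < N) F j = \sum_(i + 4 <= j < N) G j.
  by apply: eq_big_nat => j hj; apply: FG; right; lia.
by lia.
Qed.

Lemma hopsP m l' a0 a1 a2 a3 : (m, l') \in hops4 [:: a0; a1; a2; a3] ->
  exists k h, [/\ k <= 1, h \in hops3,
    m = (if head 0 h.1 == 1 then (k, k.+2) else (k.+2, k)),
    take 3 (drop k [:: a0; a1; a2; a3]) = h.1
  & l' = take k [:: a0; a1; a2; a3] ++ h.2 ++ drop k.+3 [:: a0; a1; a2; a3]].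
Proof.
case/flattenP=> s /mapP [k hk ->] /mapP [h]; rewrite mem_filter.
case/andP=> /eqP e hh [-> ->]; exists k, h; split=> //.
by move: hk; rewrite !inE => /orP [] /eqP ->.
Qed.

Lemma spathsP p b0 b1 b2 b3 s : s \in spaths p [:: b0; b1; b2; b3] ->
  exists s0 s1 s2 s3, [/\ s = [:: s0; s1; s2; s3],
    s0 \in delta p b0, s1 \in delta s0 b1, s2 \in delta s1 b2 & s3 \in delta s2 b3].
Proof.
case/flattenP=> ? /mapP [s0 h0 ->] /mapP [? + ->].
case/flattenP=> ? /mapP [s1 h1 ->] /mapP [? + ->].
case/flattenP=> ? /mapP [s2 h2 ->] /mapP [? + ->].
case/flattenP=> ? /mapP [s3 h3 ->] /mapP [? + ->].
by rewrite inE => /eqP ->; exists s0, s1, s2, s3.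
Qed.

Lemma nth_tape u j : j < size u -> nth 0 (tape u) j = nth false u j.
Proof. by move=> hj; rewrite nth_cat size_map hj (nth_map false). Qed.

Lemma size_tape u : size (tape u) = (size u).+1.
Proof. by rewrite size_cat size_map addn1. Qed.

Lemma sum_tape u :
  \sum_(0 <= j < (size u).+1) (nth 0 (tape u) j == 1) = pegs u.
Proof.
rewrite -size_tape -(big_nth 0 predT (fun a => nat_of_bool (a == 1))).
rewrite big_cat big_seq1 /= addn0 big_map /pegs -sum1_count [RHS]big_mkcond /=.
by apply: eq_bigr => -[].
Qed.

Lemma hop_pegs m u v : hop m u v -> pegs u = (pegs v).+1.
Proof. by case=> x y; rewrite /pegs !count_cat /=; lia. Qed.

Lemma hop_size m u v : hop m u v -> size u = size v.
Proof. by case=> x y; rewrite !size_cat. Qed.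

Lemma tape_hop u k h : h \in hops3 -> k.+2 <= size u ->
  (forall d, d < 3 -> nth 0 (tape u) (k + d) = nth 0 h.1 d) ->
  exists2 v, hop (if head 0 h.1 == 1 then (k, k.+2) else (k.+2, k)) u v &
    forall j, nth 0 (tape v) j =
      if k <= j < k + 3 then nth 0 h.2 (j - k) else nth 0 (tape u) j.
Proof.
move=> hh hk e.
(* Otherwise the third letter would be the end marker, which occurs in no hop pattern. *)
have hk3 : k.+2 < size u.
  rewrite ltn_neqAle hk andbT; apply/eqP => e2.
  have := e 2 isT; rewrite addn2 e2 nth_cat size_map ltnn subnn.
  by move: hh; rewrite !inE => /orP [] /eqP ->.
have e' d : d < 3 -> nth false u (k + d) = (nth 0 h.1 d == 1).
  move=> hd; rewrite -(e d hd) nth_tape; last by lia.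
  by case: nth.
have eu : u = take k u ++ [seq a == 1 | a <- h.1] ++ drop k.+3 u.
  rewrite -{1}(cat_take_drop k u) (drop_nth false) 1?(drop_nth false (n := k.+1)).
  - rewrite (drop_nth false (n := k.+2)) //.
    have := (e' 0 isT, (e' 1 isT, e' 2 isT)).
    rewrite addn0 addn1 addn2 => -[-> [-> ->]].
    by move: hh; rewrite !inE => /orP [] /eqP ->.
  - by lia.
  - by lia.
have sk : size (take k u) = k by rewrite size_takel; lia.
move: (take k u) (drop k.+3 u) sk eu => x y <- -> {u k hk e hk3 e'}.
exists (x ++ [seq a == 1 | a <- h.2] ++ y).
  move: hh; rewrite !inE => /orP [] /eqP -> /=; first exact: hop_right.
  exact: hop_left.
move=> j; rewrite /tape !map_cat -!catA !nth_cat !size_map.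
have -> : size h.2 = 3 by move: hh; rewrite !inE => /orP [] /eqP ->.
have -> : size h.1 = 3 by move: hh; rewrite !inE => /orP [] /eqP ->.
case: (ltnP j (size x)) => //= jk; rewrite -ltn_subLR //; case: ltnP => // jk3.
move: hh; rewrite !inE => /orP [] /eqP -> /=;
  by case: (j - size x) jk3 => [|[|[|]]].
Qed.

(** Only the four letters and the three states strictly inside the window change. A rewrite ends in
    the state that already follows the window, so the path stays connected. *)
Lemma rewrite_step u A q A' q' i m l s :
  (forall j, j <= size u -> A j = nth 0 (tape u) j) ->
  (forall j, j <= size u -> q j.+1 \in delta (q j) (A j)) ->
  i + 3 <= size u ->
  (m, l, s) \in rewrites (window A q i) (q (i + 4)) ->
  (forall d, d < 4 -> A' (i + d) = nth 0 l d) ->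
  (forall j, j < i \/ i + 4 <= j -> A' j = A j) ->
  (forall d, d < 3 -> q' (i + d.+1) = nth 0 s d) ->
  (forall j, j <= i \/ i + 4 <= j -> q' j = q j) ->
  exists v, [/\ hop (i + m.1, i + m.2) u v,
    forall j, j <= size u -> A' j = nth 0 (tape v) j,
    forall j, j <= size u -> q' j.+1 \in delta (q' j) (A' j)
  & \sum_(0 <= j < (size u).+1) cost (q' j) (A' j) <=
    \sum_(0 <= j < (size u).+1) cost (q j) (A j)].
Proof.
move=> Au path hi /flattenP [? /mapP [[m' l'] hl ->]] /mapP [s']; rewrite mem_filter.
case/andP=> /andP [/eqP last_s cost_s] hs [? ? ?]; subst m' l' s'.
rewrite [head _ _]/= in last_s cost_s hs.
have [k [h [k1 hh em el e']]] := hopsP hl => A'i A'j q'i q'j.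
have [|d hd|v hv ev] := @tape_hop u (i + k) h hh.
- by lia.
- rewrite -el -Au; last by lia.
  rewrite nth_take // nth_drop -addnA /=.
  have : k + d < 4 by lia.
  by case: (k + d) => [|[|[|[|]]]] //= _; rewrite ?addn0 ?addn1 ?addn2 ?addn3.
exists v.
have hA' j : j <= size u -> A' j = nth 0 (tape v) j.
  move=> hj; rewrite ev -Au //.
  case: (ltnP j i) => ji.
    by rewrite (A'j j (or_introl ji)); case: ifP => //; lia.
  case: (ltnP j (i + 4)) => ji4; last first.
    by rewrite (A'j j (or_intror ji4)); case: ifP => //; lia.
  have [d hd ->] : exists2 d, d < 4 & j = i + d by exists (j - i); lia.
  rewrite A'i // e' leq_add2l -addnA ltn_add2l subnDl.
  move: k1 hh; rewrite !inE => k1 /orP [] /eqP -> /=;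
    case: k k1 {em el e' hv ev} => [|[|]] //= _;
    move: d hd => [|[|[|[|]]]] //= _; by rewrite ?addn0 ?addn1 ?addn2 ?addn3.
have [s0 [s1 [s2 [s3]]]] : exists s0 s1 s2 s3,
    [/\ s = [:: s0; s1; s2; s3], s0 \in delta (q i) (nth 0 l 0),
        s1 \in delta s0 (nth 0 l 1), s2 \in delta s1 (nth 0 l 2)
      & s3 \in delta s2 (nth 0 l 3)].
  apply: spathsP; move: hs; congr (_ \in spaths _ _).
  rewrite e'; move: k1 hh; rewrite !inE => k1 /orP [] /eqP -> /=;
    by case: k k1 {em el e' hv ev} => [|[|]].
case=> es h0 h1 h2 h3; rewrite es /= in last_s.
have a0 : A' i = nth 0 l 0 by rewrite -A'i ?addn0.
have a1 : A' i.+1 = nth 0 l 1 by rewrite -A'i ?addn1.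
have a2 : A' i.+2 = nth 0 l 2 by rewrite -A'i ?addn2.
have a3 : A' i.+3 = nth 0 l 3 by rewrite -A'i ?addn3.
have b0 : q' i = q i by apply: q'j; left.
have b1 : q' i.+1 = s0 by rewrite -addn1 q'i // es.
have b2 : q' i.+2 = s1 by rewrite -addn2 q'i // es.
have b3 : q' i.+3 = s2 by rewrite -addn3 q'i // es.
have b4 : q' i.+4 = s3 by rewrite -addn4 q'j ?last_s //; right.
split=> //.
- by move: hv; rewrite em; case: ifP => _; rewrite /= ?addnS.
- move=> j hj; case: (ltnP j i) => ji.
    by rewrite !q'j ?A'j ?path //; lia.
  case: (ltnP j (i + 4)) => ji4; last by rewrite !q'j ?A'j ?path //; lia.
  have [d hd ->] : exists2 d, d < 4 & j = i + d by exists (j - i); lia.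
  move: d hd => [|[|[|[|]]]] //= _.
  + by rewrite addn0 b0 b1 a0.
  + by rewrite addn1 b1 b2 a1.
  + by rewrite addn2 b2 b3 a2.
  + by rewrite addn3 b3 b4 a3.
(* The two cost sequences agree outside the window, so comparing the window costs compares the
   totals. *)
have := @big_window (fun j => cost (q j) (A j)) (fun j => cost (q' j) (A' j)) i (size u).+1.
have e4 : pcost (q i) l s = cost (q' i) (A' i) + cost (q' i.+1) (A' i.+1) +
    cost (q' i.+2) (A' i.+2) + cost (q' i.+3) (A' i.+3).
  rewrite b0 b1 b2 b3 a0 a1 a2 a3 es.
  have : size l = 4.
    rewrite e'; move: k1 hh; rewrite !inE => k1 /orP [] /eqP -> /=;
    by case: k k1 {em el e' hv ev} => [|[|]].
  by case: l {hl A'i e' hs cost_s a0 a1 a2 a3 h0 h1 h2 h3} => [|? [|? [|? [|? [|]]]]] //= _; lia.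
move: cost_s; rewrite e4 /=; move=> hc /(_ _ _) hw.
have {}hw := hw ltac:(lia) ltac:(by move=> j hj; rewrite q'j ?A'j //; lia).
by move: hw hc => /=; lia.
Qed.

(** These bounds guarantee that every value to be written sits in a constant register, and every hop
    position in one of the first four address registers. *)
Lemma rewrites_small A q i p m l s :
  (forall d, d < 4 -> A (i + d) <= 2) ->
  (m, l, s) \in rewrites (window A q i) p ->
  [/\ m.1 < 4, m.2 < 4, forall d, nth 0 l d < nstates
    & forall d, nth 0 s d < nstates].
Proof.
move=> A2 /flattenP [? /mapP [[m' l'] hl ->]] /mapP [s']; rewrite mem_filter.
case/andP=> _ hs [? ? ?]; subst m' l' s'.
have [k [h [k1 hh em el e]]] := hopsP hl.
have el4 : exists l0 l1 l2 l3, l = [:: l0; l1; l2; l3] /\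
    [/\ l0 <= 2, l1 <= 2, l2 <= 2 & l3 <= 2].
  have := (A2 0 isT, A2 3 isT); rewrite addn0 addn3 => -[? ?].
  rewrite e; move: k1 hh; rewrite !inE => k1 /orP [] /eqP -> /=;
    by case: k k1 {e em el} => [|[|]] //= _; do 4 eexists.
have [l0 [l1 [l2 [l3 [el' [? ? ? ?]]]]]] := el4.
split.
- by rewrite em; case: ifP => _ /=; lia.
- by rewrite em; case: ifP => _ /=; lia.
- by rewrite el' /nstates => -[|[|[|[|d]]]] /=; rewrite ?nth_nil; lia.
rewrite /= el' in hs; have [s0 [s1 [s2 [s3 [-> h0 h1 h2 h3]]]]] := spathsP hs.
case=> [|[|[|[|d]]]] /=; rewrite ?nth_nil //.
- exact: delta_lt h0.
- exact: delta_lt h1.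
- exact: delta_lt h2.
- exact: delta_lt h3.
Qed.

(** * Cheapest paths *)

Definition best (f : nat -> nat) (inf : nat) (l : seq nat) : nat * nat :=
  foldl (fun b r => if f r < b.1 then (f r, r) else b) (inf, 0) l.

Lemma best_le f inf l r : r \in l -> (best f inf l).1 <= f r.
Proof.
elim/last_ind: l => // l x IH.
rewrite mem_rcons inE /best foldl_rcons -/(best f inf l) => /orP [/eqP -> | /IH].
  by case: ltnP.
by case: ltnP => //= h h'; apply: leq_trans h'; apply: ltnW.
Qed.

Lemma best_mem f inf l : (best f inf l).1 < inf ->
  (best f inf l).2 \in l /\ f (best f inf l).2 = (best f inf l).1.
Proof.
elim/last_ind: l => [|l x IH]; first by rewrite /= ltnn.
rewrite mem_rcons inE /best foldl_rcons -/(best f inf l).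
case: (ltnP (f x)) => _ /= h; first by rewrite eqxx.
by have [-> ->] := IH h; rewrite orbT.
Qed.

(** The cap [inf] can only lower entries, so [D] bounds the cost of every path from below; an entry
    less than [inf] is attained by following [B]. *)
Definition dp_table (w : word) (D B : nat -> nat -> nat) (inf : nat) : Prop :=
  (forall p, p < nstates -> D p (size w).+1 = if p == final then 0 else inf) /\
  (forall p j, p < nstates -> j <= size w ->
     D p j = (best (D^~ j.+1) inf (delta p (nth 0 (tape w) j))).1
             + cost p (nth 0 (tape w) j) /\
     B p j = (best (D^~ j.+1) inf (delta p (nth 0 (tape w) j))).2).

Lemma dp_reach w D B inf p c : dp_table w D B inf -> p < nstates ->
  reach p (tape w) c -> D p 0 <= c.
Proof.
case=> Dfin Dstep.
suff h j q d : j <= (size w).+1 -> q < nstates ->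
    reach q (drop j (tape w)) d -> D q j <= d.
  by move=> hp hr; apply: h; rewrite ?drop0.
move e: ((size w).+1 - j) => k; elim: k j q d e => [|k IH] j p' c' e hj hp.
  have -> : j = (size w).+1 by lia.
  rewrite -size_tape drop_size => h; inversion h; subst.
  by rewrite size_tape Dfin.
have jw : j <= size w by lia.
rewrite (drop_nth 0) ?size_tape // => /reach_inv [r [d [hq hr ->]]].
have [-> _] := Dstep p' j hp jw.
rewrite addnC leq_add2l; apply: leq_trans (best_le _ _ hq) _.
by apply: IH hr; [lia | lia | exact: delta_lt hq].
Qed.

Lemma dp_walk w D B inf q : dp_table w D B inf ->
  D stuck 0 < inf -> q 0 = stuck ->
  (forall j, j <= size w -> q j.+1 = B (q j) j) ->
  [/\ q (size w).+1 = final,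
      forall j, j <= size w -> q j.+1 \in delta (q j) (nth 0 (tape w) j)
    & \sum_(0 <= j < (size w).+1) cost (q j) (nth 0 (tape w) j) = D stuck 0].
Proof.
case=> Dfin Dstep Dinf q0 qS.
(* Entries do not increase along the walk, so they stay below [inf] and [best_mem] applies at each
   step. *)
have inv j : j <= (size w).+1 ->
  [/\ q j < nstates, D (q j) j < inf,
      forall i, i < j -> q i.+1 \in delta (q i) (nth 0 (tape w) i)
    & \sum_(0 <= i < j) cost (q i) (nth 0 (tape w) i) + D (q j) j = D stuck 0].
  elim: j => [|j IH] hj.
    by rewrite q0 big_nil; split.
  have [qj Dj path sum] := IH (ltnW hj).
  have [e1 e2] := Dstep (q j) j qj hj.
  have h : (best (D^~ j.+1) inf (delta (q j) (nth 0 (tape w) j))).1 < inf by lia.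
  have [m e] := best_mem h.
  rewrite -e2 -qS // in m e.
  split; first exact: delta_lt m.
  - by rewrite e.
  - by move=> i; rewrite ltnS leq_eqVlt => /orP [/eqP -> | /path].
  by rewrite big_nat_recr //= -sum e e1; lia.
have [qN DN path sum] := inv _ (leqnn _).
have e : q (size w).+1 = final.
  by apply/eqP; apply: contraLR DN => h; rewrite Dfin // (negbTE h) ltnn.
split; [exact: e | by move=> j hj; apply: path | ].
by rewrite -sum Dfin ?qN // e eqxx addn0.
Qed.

(** * Execution of programs *)

Fixpoint flat (c : cmd) : bool :=
  match c with
  | Seq c1 c2 | If _ c1 c2 => flat c1 && flat c2
  | While _ _ => false
  | _ => true
  end.

Fixpoint run (c : cmd) (s : state) : state :=
  match c with
  | Skip | While _ _ => s
  | Const x k => set_reg s x k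
  | Copy x y => set_reg s x (regs s y)
  | Inc x => set_reg s x (regs s x).+1
  | Dec x => set_reg s x (regs s x).-1
  | Read x a y => set_reg s x (Defs.mem s a (regs s y))
  | Write a y x => set_mem s a (regs s y) (regs s x)
  | Seq c1 c2 => run c2 (run c1 s)
  | If b c1 c2 => if eval b s then run c1 s else run c2 s
  end.

Fixpoint max_time (c : cmd) : nat :=
  match c with
  | Seq c1 c2 => max_time c1 + max_time c2
  | If _ c1 c2 => (maxn (max_time c1) (max_time c2)).+1
  | _ => 1
  end.

Lemma exec_run c s : flat c ->
  exists2 t, exec c s t (run c s) & t <= max_time c.
Proof.
elim: c s => [|x k|x y|x|x|x a y|a y x|c1 IH1 c2 IH2|b c1 IH1 c2 IH2|//] s /=;
  try by exists 1 => //; constructor.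
  case/andP=> /(IH1 s) [t1 h1 b1] /(IH2 (run c1 s)) [t2 h2 b2].
  by exists (t1 + t2); [exact: exec_seq h1 h2 | exact: leq_add].
case/andP=> /(IH1 s) [t1 h1 b1] /(IH2 s) [t2 h2 b2].
case e: (eval b s).
  by exists t1.+1; [apply: exec_if; rewrite e | rewrite ltnS leq_max b1].
by exists t2.+1; [apply: exec_if; rewrite e | rewrite ltnS leq_max b2 orbT].
Qed.

(** The measure bounds the number of passes, and a pass costs one test and at most [max_time c], a
    bound independent of the state. *)
Lemma exec_while (I : state -> Prop) (m : state -> nat) b c s :
  flat c -> I s ->
  (forall s, I s -> eval b s -> I (run c s) /\ m (run c s) < m s) ->
  exists t s', [/\ exec (While b c) s t s', t <= (max_time c).+1 * (m s) + 1,
                  I s' & ~~ eval b s'].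
Proof.
move=> fc + step; move e: (m s) => k.
elim/ltn_ind: k s e => k IH s e Is; case eb: (eval b s); last first.
  by exists 1, s; rewrite eb leq_addl; split=> //; apply: exec_while_done; rewrite eb.
have [Is1 ms1] := step s Is eb; rewrite e in ms1.
have [t2 [s2 [h2 b2 Is2 nb]]] := IH _ ms1 _ (erefl _) Is1.
have [t1 h1 b1] := exec_run s fc.
exists (t1 + t2).+1, s2; split=> //; first exact: exec_while_loop eb h1 h2.
have : (max_time c).+1 * (m (run c s)).+1 <= (max_time c).+1 * k by rewrite leq_mul2l.
by rewrite mulnS; lia.
Qed.

Definition seqs (l : seq cmd) : cmd := foldr Seq Skip l.

(** The constant [k] is kept in register [30 + k], so that branching on the
    value of a register needs no scratch register. *)
Definition cst (k : nat) : reg := 30 + k.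

Definition has_consts (b : nat) (s : state) : Prop :=
  forall k, k < b -> regs s (cst k) = k.

Fixpoint switch (x : reg) (b : nat) (f : nat -> cmd) : cmd :=
  match b with
  | 0 => Skip
  | k.+1 => If (Eq x (cst k)) (f k) (switch x k f)
  end.

Lemma flat_switch x b f : (forall k, flat (f k)) -> flat (switch x b f).
Proof. by move=> h; elim: b => //= k ->; rewrite h. Qed.

Lemma run_switch x b f s : has_consts b s -> regs s x < b ->
  run (switch x b f) s = run (f (regs s x)) s.
Proof.
elim: b => //= k IH hc; rewrite hc // ltnS leq_eqVlt.
case: eqP => [-> // | _ /= h]; apply: IH => // i hi.
by apply: hc; apply: ltnW.
Qed.

(** A finite function of several registers is compiled into a decision tree: the code at a leaf is
    computed from the register values that lead to it. *)
Fixpoint switches (xs : seq reg) (b : nat) (f : seq nat -> cmd) : cmd :=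
  match xs with
  | [::] => f [::]
  | x :: xs' => switch x b (fun v => switches xs' b (fun l => f (v :: l)))
  end.

Lemma flat_switches xs b f : (forall l, flat (f l)) -> flat (switches xs b f).
Proof.
elim: xs f => [|x xs IH] f h //=.
by apply: flat_switch => v; apply: IH.
Qed.

Lemma run_switches xs b f s : has_consts b s -> all (fun x => regs s x < b) xs ->
  run (switches xs b f) s = run (f [seq regs s x | x <- xs]) s.
Proof.
elim: xs f => [|x xs IH] f hc //= /andP [hx hxs].
by rewrite run_switch // IH.
Qed.

(** * The program *)

Lemma run_seqs_cat l1 l2 s :
  run (seqs (l1 ++ l2)) s = run (seqs l2) (run (seqs l1) s).
Proof. by elim: l1 s => //=. Qed.

Lemma run_seqs_cons c l s : run (seqs (c :: l)) s = run (seqs l) (run c s).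
Proof. by []. Qed.

(** Register 2 is the cursor and register 3 holds [n + 1], which also serves as
    an infinite cost.  The entries at index [j] of [cost_arr p] and [next_arr p]
    are the least cost of a path from [p] over the suffix starting at [j] and the
    second state of such a path.  Array 3 holds the current path. *)
Definition cost_arr (p : nat) : arr := 10 + p.
Definition next_arr (p : nat) : arr := 40 + p.

Definition init : cmd :=
  seqs ([seq Const (cst k) k | k <- iota 0 nstates]
        ++ [:: Copy 3 0; Inc 3; Write 0 0 (cst 2)]
        ++ [seq Write (cost_arr p) 3 (if p == final then cst 0 else 3)
           | p <- iota 0 nstates]
        ++ [:: Copy 2 3]).

(** Register 5 holds the index after the cursor; registers 6 and 7 hold the running pair of
    [best]. *)
Definition relax (r : nat) : cmd :=
  Seq (Read 8 (cost_arr r) 5)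
      (If (Lt 8 6) (Seq (Copy 6 8) (Copy 7 (cst r))) Skip).

Definition dp_node (p a : nat) : cmd :=
  seqs ([:: Copy 6 3; Copy 7 (cst 0)]
        ++ [seq relax r | r <- delta p a]
        ++ [:: if cost p a == 1 then Inc 6 else Skip;
               Write (cost_arr p) 2 6; Write (next_arr p) 2 7]).

Definition dp_body : cmd :=
  seqs [:: Copy 5 2; Dec 2; Read 9 0 2;
           switch 9 nstates (fun a => seqs [seq dp_node p a | p <- iota 0 nstates])].

Definition walk_body : cmd :=
  seqs [:: Read 5 3 2; switch 5 nstates (fun p => Read 6 (next_arr p) 2);
           Inc 2; Write 3 2 6].

Definition window_regs : seq reg := [:: 15; 20; 16; 21; 17; 22; 18; 23; 19].

(** Registers 10 to 14 hold the addresses of the window. The fourth state of [t] is already in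
    place. *)
Definition write_rewrite (m : nat * nat) (l t : seq nat) : cmd :=
  seqs ([seq Write 0 (10 + d) (cst (nth 0 l d)) | d <- iota 0 4]
        ++ [seq Write 3 (11 + d) (cst (nth 0 t d)) | d <- iota 0 3]
        ++ [:: Write 1 1 (10 + m.1); Write 2 1 (10 + m.2); Inc 1;
               Dec 2; Dec 2; Dec 2]).

Definition apply_rewrite (l : seq nat) : cmd :=
  match l with
  | [:: p0; a0; p1; a1; p2; a2; p3; a3; p4] =>
      match rewrites [:: (p0, a0); (p1, a1); (p2, a2); (p3, a3)] p4 with
      | [::] => Inc 2
      | (m, l', s) :: _ => write_rewrite m l' s
      end
  | _ => Skip
  end.

Definition load_window : cmd :=
  seqs [:: Copy 10 2; Copy 11 10; Inc 11; Copy 12 11; Inc 12;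
           Copy 13 12; Inc 13; Copy 14 13; Inc 14;
           Read 15 3 10; Read 16 3 11; Read 17 3 12; Read 18 3 13; Read 19 3 14;
           Read 20 0 10; Read 21 0 11; Read 22 0 12; Read 23 0 13].

(** Register 9 is kept three ahead of the cursor, so that the loop test asks whether a full window
    still fits. *)
Definition rewrite_body : cmd :=
  seqs [:: load_window;
           switches window_regs nstates apply_rewrite;
           Copy 9 2; Inc 9; Inc 9; Inc 9].

Definition solver : cmd :=
  seqs [:: init;
           While (Lt (cst 0) 2) dp_body;
           Const 2 0; Write 3 2 (cst stuck);
           While (Lt 2 3) walk_body;
           Const 2 0; Const 9 3;
           While (Lt 9 3) rewrite_body].

(** * Memory after initialisation *)

Lemma run_consts l s x :
  regs (run (seqs [seq Const (cst k) k | k <- l]) s) x =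
    (if (30 <= x) && (x - 30 \in l) then x - 30 else regs s x) /\
  Defs.mem (run (seqs [seq Const (cst k) k | k <- l]) s) = Defs.mem s.
Proof.
elim: l s => [|k l IH] s; first by rewrite in_nil andbF.
have [/= -> ->] := IH (set_reg s (cst k) k); split=> //.
rewrite inE /cst; case: (leqP 30 x) => /= hx; last first.
  by case: eqP => // e; move: hx; rewrite e; lia.
case: (x - 30 \in l); rewrite ?orbT ?orbF //.
have -> : (x == 30 + k) = (x - 30 == k) by lia.
by case: eqP => [->|].
Qed.

Lemma run_writes (l : seq nat) (y : nat -> reg) s b j :
  regs (run (seqs [seq Write (cost_arr p) 3 (y p) | p <- l]) s) = regs s /\
  Defs.mem (run (seqs [seq Write (cost_arr p) 3 (y p) | p <- l]) s) b j =
    if (j == regs s 3) && (10 <= b) && (b - 10 \in l) then regs s (y (b - 10))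
    else Defs.mem s b j.
Proof.
elim: l s => [|p l IH] s; first by rewrite in_nil andbF.
have [/= -> ->] := IH (set_mem s (cost_arr p) (regs s 3) (regs s (y p))).
split=> //=; rewrite inE /cost_arr.
case: (j == _); rewrite ?andbF //= !andbT.
case: (leqP 10 b) => /= hb; last by case: eqP => // e; move: hb; rewrite e; lia.
case: (b - 10 \in l); rewrite ?orbT ?orbF //.
have -> : (b == 10 + p) = (b - 10 == p) by lia.
by case: eqP => [->|].
Qed.

Definition frame (w : word) (s : state) : Prop :=
  [/\ has_consts nstates s, regs s 1 = 0, regs s 3 = (size w).+1
    & forall j, j <= size w -> Defs.mem s 0 j = nth 0 (tape w) j].

Lemma run_init w : let s := run init (input w) in
  [/\ frame w s, regs s 2 = (size w).+1
    & forall p, p < nstates ->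
        Defs.mem s (cost_arr p) (size w).+1 =
        if p == final then 0 else (size w).+1].
Proof.
rewrite /init run_seqs_cat.
have hc := run_consts (iota 0 nstates) (input w).
move: (run _ (input w)) hc => s1 hc.
have em : Defs.mem s1 = Defs.mem (input w) by have [] := hc 0.
have consts k : k < nstates -> regs s1 (cst k) = k.
  move=> hk; have [-> _] := hc (cst k).
  by rewrite /cst leq_addr addnC addnK mem_iota /= add0n hk.
have r0 : regs s1 0 = size w by have [-> _] := hc 0.
have r1 : regs s1 1 = 0 by have [-> _] := hc 1.
rewrite run_seqs_cat; set s2 := run _ s1.
have r2 x : regs s2 x = if x == 3 then (size w).+1 else regs s1 x.
  by rewrite /s2 /= r0; case: eqP.
have m2 b j : Defs.mem s2 b j = if (b == 0) && (j == size w) then 2 else Defs.mem s1 b j.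
  rewrite /s2 /= r0.
  by have -> : regs s1 32 = 2 by exact: (consts 2).
clearbody s2; rewrite run_seqs_cat.
have hw := @run_writes (iota 0 nstates) (fun p => if p == final then cst 0 else 3) s2.
move: (run _ s2) hw => s3 hw.
have r3 : regs s3 = regs s2 by have [] := hw 0 0.
have c3 k : k < nstates -> regs s3 (cst k) = k.
  by move=> hk; rewrite r3 r2 -[RHS]consts.
rewrite /=; split.
- split=> //=.
  + by rewrite r3 r2.
  + by rewrite r3 r2.
  move=> j hj; have [_ ->] := hw 0 j; rewrite andbF /= m2 em /=.
  case: eqP => [->|/eqP hn]; first by rewrite nth_cat size_map ltnn subnn.
  by rewrite nth_tape // ltn_neqAle hn.
- by rewrite r3 r2.
move=> p hp; have [_ ->] := hw (cost_arr p) (size w).+1.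
rewrite r2 eqxx /cost_arr leq_addr addnC addnK mem_iota /= add0n hp.
rewrite eqxx; case: eqP => _; [by rewrite -r3; exact: (c3 0) | by rewrite r2].
Qed.

(** * The dynamic-programming loop *)

Lemma run_relax (l : seq nat) s : has_consts nstates s -> all (ltn^~ nstates) l ->
  let s' := run (seqs [seq relax r | r <- l]) s in
  [/\ Defs.mem s' = Defs.mem s,
      forall x, x \notin [:: 6; 7; 8] -> regs s' x = regs s x
    & (regs s' 6, regs s' 7) =
      foldl (fun b r => if Defs.mem s (cost_arr r) (regs s 5) < b.1
                        then (Defs.mem s (cost_arr r) (regs s 5), r) else b)
            (regs s 6, regs s 7) l].
Proof.
elim: l s => [|r l IH] s hc //= /andP [hr hl].
set s1 := (if _ then _ else _).
have [m1 r1 e1] : [/\ Defs.mem s1 = Defs.mem s,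
      forall x, x \notin [:: 6; 7; 8] -> regs s1 x = regs s x
    & (regs s1 6, regs s1 7) =
      if Defs.mem s (cost_arr r) (regs s 5) < regs s 6
      then (Defs.mem s (cost_arr r) (regs s 5), r) else (regs s 6, regs s 7)].
  rewrite /s1; case: ifP => h; split=> //=.
  - by move=> x; rewrite !inE !negb_or => /and3P [/negbTE e6 /negbTE e7 /negbTE e8];
      rewrite ?e6 ?e7 ?e8.
  - by rewrite (hc r hr : regs s (30 + r) = r).
  by move=> x; rewrite !inE !negb_or => /and3P [/negbTE e6 /negbTE e7 /negbTE e8];
      rewrite ?e6 ?e7 ?e8.
have hc1 : has_consts nstates s1 by move=> k hk; rewrite r1 ?hc.
have [m2 r2 e2] := IH s1 hc1 hl.
split; first by rewrite m2 m1.
  by move=> x hx; rewrite r2 ?r1.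
by rewrite e2 e1 m1 (r1 5).
Qed.

Lemma run_dp_node p a s : has_consts nstates s -> 
  let v := best (fun r => Defs.mem s (cost_arr r) (regs s 5)) (regs s 3) (delta p a) in
  let s' := run (dp_node p a) s in
  (forall x, x \notin [:: 6; 7; 8] -> regs s' x = regs s x) /\
  (forall b j, Defs.mem s' b j =
     if (b == next_arr p) && (j == regs s 2) then v.2
     else if (b == cost_arr p) && (j == regs s 2) then v.1 + cost p a
     else Defs.mem s b j).
Proof.
move=> hc v s'; rewrite /s' /dp_node !run_seqs_cat {s'}.
set s1 := run _ s.
have hc1 : has_consts nstates s1 by move=> k hk; rewrite -[RHS]hc.
have hl : all (ltn^~ nstates) (delta p a).
  by apply/allP => q; apply: delta_lt.
have [m2 r2 e2] := run_relax hc1 hl.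
move: (run _ s1) m2 r2 e2 => s2 m2 r2.
have -> : (regs s1 6, regs s1 7) = (regs s 3, 0).
  by rewrite /s1 /= (hc 0 isT : regs s 30 = 0).
have -> : regs s1 5 = regs s 5 by [].
rewrite -[foldl _ _ _]/v; case: v => v1 v2 [e6 e7] /=.
have r2' x : x \notin [:: 6; 7; 8] -> regs s2 x = regs s x.
  move=> hx; rewrite r2 // /s1 /=; move: hx; rewrite !inE !negb_or.
  by case/and3P=> /negbTE -> /negbTE -> _.
have ce : cost p a = (cost p a == 1) by rewrite /cost; case: (_ && _).
split.
  move=> x hx; rewrite -r2' //; case: ifP => //= _.
  by move: hx; rewrite !inE; case: (x == 6).
move=> b j; have := r2' 2 isT; rewrite [X in v1 + X]ce.
by case: (cost p a == 1) => /= ->; rewrite e6 e7 m2 ?addn0 ?addn1.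
Qed.

Lemma eq_best f g inf l : f =1 g -> best f inf l = best g inf l.
Proof.
move=> fg; rewrite /best; elim: l (inf, 0) => //= x l IH b.
by rewrite fg IH.
Qed.

(** Costs are read at index [regs s 5] and written at [regs s 2]; as these differ, no node sees the
    result of another. *)
Lemma run_dp_nodes a (l : seq nat) s : has_consts nstates s ->
  regs s 5 != regs s 2 -> all (ltn^~ nstates) l ->
  let v p := best (fun r => Defs.mem s (cost_arr r) (regs s 5)) (regs s 3) (delta p a) in
  let s' := run (seqs [seq dp_node p a | p <- l]) s in
  [/\ forall x, x \notin [:: 6; 7; 8] -> regs s' x = regs s x,
      forall b j, j != regs s 2 \/
        (forall p, p \in l -> (b != cost_arr p) && (b != next_arr p)) ->
        Defs.mem s' b j = Defs.mem s b j
    & forall p, p \in l ->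
        Defs.mem s' (cost_arr p) (regs s 2) = (v p).1 + cost p a /\
        Defs.mem s' (next_arr p) (regs s 2) = (v p).2].
Proof.
move=> + r52; elim: l s r52 => [|p l IH] s r52 hc; first by move=> _; split.
move=> /andP [hp hl] v s'.
rewrite -[s']/(run (seqs [seq dp_node p a | p <- l]) (run (dp_node p a) s)) {s'}.
have [r1 m1] := run_dp_node p a hc; move: (run (dp_node p a) s) r1 m1 => s1 r1 m1.
have hc1 : has_consts nstates s1 by move=> k hk; rewrite r1 ?hc.
have := IH s1; rewrite !(r1 2) // !(r1 5) // (r1 3) //.
case/(_ r52 hc1 hl) => r2 m2 e2.
have ev q : best (fun r => Defs.mem s1 (cost_arr r) (regs s 5)) (regs s 3) (delta q a)
          = best (fun r => Defs.mem s (cost_arr r) (regs s 5)) (regs s 3) (delta q a).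
  by apply: eq_best => r; rewrite m1 (negbTE r52) !andbF.
split.
- by move=> x hx; rewrite -(r1 x hx); exact: r2.
- move=> b j hb; apply: etrans (m2 b j _) _.
    by case: hb => hb; [left | right => q ql; apply: hb; rewrite inE ql orbT].
  rewrite m1; case: hb => [/negbTE -> | /(_ p (mem_head _ _)) /andP [/negbTE -> /negbTE ->] //].
  by rewrite !andbF.
move=> q; rewrite inE; case: (boolP (q \in l)) => [/e2 [-> ->] _|ql].
  by rewrite ev.
rewrite orbF => /eqP eq; rewrite {}eq in ql *.
(* States are below 21, so the cost arrays 10 to 30 and the successor arrays 40 to 60 do not
   overlap. *)
have fresh b : b \in [:: cost_arr p; next_arr p] ->
    forall q, q \in l -> (b != cost_arr q) && (b != next_arr q).
  have p21 : p < 21 := hp.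
  move=> hb r rl; have r21 : r < 21 by have /allP/(_ _ rl) := hl.
  have rp : r != p by apply: contraNneq ql => <-.
  move: hb; rewrite !inE /cost_arr /next_arr => /orP [] /eqP ->.
    by rewrite eqn_add2l eq_sym rp /=; lia.
  by rewrite eqn_add2l [p == r]eq_sym rp andbT; lia.
split.
  apply: etrans (m2 _ _ _) _; first by right; apply: fresh; rewrite !inE eqxx.
  by rewrite m1 !eqxx /next_arr /cost_arr; case: eqP => //; lia.
apply: etrans (m2 _ _ _) _; first by right; apply: fresh; rewrite !inE eqxx orbT.
by rewrite m1 !eqxx.
Qed.

Lemma tape_le2 w j : nth 0 (tape w) j <= 2.
Proof.
case: (ltngtP j (size w)) => hj.
- by rewrite nth_tape //; case: nth.
- by rewrite nth_default // size_tape.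
by rewrite hj nth_cat size_map ltnn subnn.
Qed.

Lemma frame_eq w s s' : frame w s ->
  (forall x, x \notin [:: 2; 5; 6; 7; 8; 9] -> regs s' x = regs s x) ->
  (forall j, Defs.mem s' 0 j = Defs.mem s 0 j) -> frame w s'.
Proof.
case=> hc h1 h3 hm hr h0; split.
- by move=> k hk; rewrite hr ?hc.
- by rewrite hr.
- by rewrite hr.
by move=> j hj; rewrite h0 hm.
Qed.

Definition dp_inv (w : word) (s : state) : Prop :=
  [/\ frame w s, regs s 2 <= (size w).+1,
      forall p, p < nstates ->
        Defs.mem s (cost_arr p) (size w).+1 = if p == final then 0 else (size w).+1
    & forall p j, p < nstates -> regs s 2 <= j -> j <= size w ->
        let v := best (fun r => Defs.mem s (cost_arr r) j.+1) (size w).+1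
                      (delta p (nth 0 (tape w) j)) in
        Defs.mem s (cost_arr p) j = v.1 + cost p (nth 0 (tape w) j) /\
        Defs.mem s (next_arr p) j = v.2].

Lemma dp_step w s : dp_inv w s -> eval (Lt (cst 0) 2) s ->
  dp_inv w (run dp_body s) /\ regs (run dp_body s) 2 < regs s 2.
Proof.
case=> fr i_le fin rec; have [hc h1 h3 hm] := fr.
rewrite /eval hc //; move e: (regs s 2) i_le rec => [//|i] i_le rec _.
set s0 := run (seqs [:: Copy 5 2; Dec 2; Read 9 0 2]) s.
have r0 x : regs s0 x = if x == 9 then nth 0 (tape w) i else if x == 2 then i
                        else if x == 5 then i.+1 else regs s x.
  by rewrite /s0 /= e /= hm.
have m0 : Defs.mem s0 = Defs.mem s by [].
have c0 : has_consts nstates s0 by move=> k hk; rewrite r0 -[RHS]hc.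
have -> : run dp_body s = run (seqs [seq dp_node p (nth 0 (tape w) i) | p <- iota 0 nstates]) s0.
  rewrite -[LHS]/(run (switch 9 nstates (fun a =>
    seqs [seq dp_node p a | p <- iota 0 nstates])) s0).
  have e9 : regs s0 9 = nth 0 (tape w) i by rewrite r0.
  have l9 : regs s0 9 < nstates by rewrite e9; exact: leq_ltn_trans (tape_le2 _ _) _.
  rewrite (run_switch _ c0 l9) e9; reflexivity.
clearbody s0.
have r2 : regs s0 2 = i by rewrite r0.
have r5 : regs s0 5 = i.+1 by rewrite r0.
have r3 : regs s0 3 = (size w).+1 by rewrite r0.
have [||] := @run_dp_nodes (nth 0 (tape w) i) (iota 0 nstates) s0 c0.
- by rewrite r2 r5 gtn_eqF.
- by apply/allP => p; rewrite mem_iota.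
rewrite r2 r3 r5 m0; move: (run _ s0) => s1 r1 m1 v1.
have rr x : x \notin [:: 2; 5; 6; 7; 8; 9] -> regs s1 x = regs s x.
  rewrite !inE !negb_or => /and5P [x2 x5 x6 x7 /andP [x8 x9]].
  rewrite r1 ?r0 ?(negbTE x2) ?(negbTE x5) ?(negbTE x9) //.
  by rewrite !inE !negb_or x6 x7.
have m10 j : Defs.mem s1 0 j = Defs.mem s 0 j by apply: m1; right.
have m1j b j : i < j -> Defs.mem s1 b j = Defs.mem s b j.
  by move=> hj; apply: m1; left; rewrite gtn_eqF.
have r12 : regs s1 2 = i by rewrite r1.
split; last by rewrite r12.
split.
- exact: frame_eq fr rr m10.
- by rewrite r12 ltnW.
- by move=> p hp; rewrite m1j ?fin.
move=> p j hp; rewrite r12 leq_eqVlt => /orP [/eqP <- _ | hj jw] /=.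
  have [|-> ->] := v1 p; first by rewrite mem_iota.
  by split; [congr (_.1 + _) | congr (_.2)]; apply: eq_best => r; rewrite m1j.
have := rec p j hp hj jw; rewrite /= !m1j // => -[-> ->].
by split; [congr (_.1 + _) | congr (_.2)]; apply: eq_best => r; rewrite m1j // ltnW.
Qed.

(** * Following the tables along a cheapest path *)

Fixpoint walk (B : nat -> nat -> nat) (j : nat) : nat :=
  if j is j'.+1 then B (walk B j') j' else stuck.

Definition walk_inv (w : word) (B : nat -> nat -> nat) (s : state) : Prop :=
  [/\ frame w s, regs s 2 <= (size w).+1,
      forall p j, Defs.mem s (next_arr p) j = B p j
    & forall j, j <= regs s 2 -> Defs.mem s 3 j = walk B j].

Lemma walk_step w B s : (forall j, j <= size w -> walk B j < nstates) ->
  walk_inv w B s -> eval (Lt 2 3) s ->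
  walk_inv w B (run walk_body s) /\
  (size w).+1 - regs (run walk_body s) 2 < (size w).+1 - regs s 2.
Proof.
move=> wB [fr i_le next st]; have [hc h1 h3 hm] := fr.
rewrite /eval h3 ltnS => iw.
have e3 := st _ (leqnn _).
set s0 := run (Read 5 3 2) s.
have e : run walk_body s =
    run (seqs [:: Inc 2; Write 3 2 6]) (run (Read 6 (next_arr (walk B (regs s 2))) 2) s0).
  have e5 : regs s0 5 = walk B (regs s 2) by rewrite /s0 /= e3.
  rewrite -[LHS]/(run (seqs [:: Inc 2; Write 3 2 6])
    (run (switch 5 nstates (fun p => Read 6 (next_arr p) 2)) s0)).
  have l5 : regs s0 5 < nstates by rewrite e5; apply: wB.
  have c0 : has_consts nstates s0 by move=> k hk; rewrite -[RHS]hc.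
  rewrite (run_switch _ c0 l5) e5; reflexivity.
have r x : x \notin [:: 2; 5; 6] -> regs (run walk_body s) x = regs s x.
  rewrite e !inE !negb_or /= => /and3P [/negbTE -> /negbTE -> /negbTE ->] //.
have m b j : Defs.mem (run walk_body s) b j =
    if (b == 3) && (j == (regs s 2).+1) then walk B (regs s 2).+1 else Defs.mem s b j.
  by rewrite e /= next.
have r2 : regs (run walk_body s) 2 = (regs s 2).+1 by rewrite e.
split; last by rewrite r2; lia.
split.
- apply: frame_eq fr _ _ => [x | j]; last by rewrite m.
  by move=> hx; apply: r; move: hx; rewrite !inE !negb_or => /and5P [-> -> -> _ _].
- by rewrite r2.
- by move=> p j; rewrite m; exact: next.
move=> j; rewrite r2 m leq_eqVlt => /orP [/eqP -> | hj]; first by rewrite !eqxx.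
by rewrite (ltn_eqF hj) andbF st.
Qed.

(** * The rewriting sweep *)

Lemma run_load_window s : let s' := run load_window s in let i := regs s 2 in
  let A := Defs.mem s 0 in let q := Defs.mem s 3 in
  [/\ Defs.mem s' = Defs.mem s,
      forall x, x < 10 \/ 23 < x -> regs s' x = regs s x,
      forall d, d < 5 -> regs s' (10 + d) = i + d
    & [seq regs s' x | x <- window_regs] =
      [:: q i; A i; q i.+1; A i.+1; q i.+2; A i.+2; q i.+3; A i.+3; q i.+4]].
Proof.
split=> //.
  move=> x hx; rewrite /=.
  by do 14!(case: eqP => [?|_]; first by lia).
by case=> [|[|[|[|[|]]]]] //= _; rewrite ?addn0 ?addn1 ?addn2 ?addn3 ?addn4.
Qed.

Lemma run_write_rewrite s i m l t : let s' := run (write_rewrite m l t) s in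
  has_consts nstates s -> (forall d, d < 5 -> regs s (10 + d) = i + d) ->
  m.1 < 4 -> m.2 < 4 -> (forall d, nth 0 l d < nstates) ->
  (forall d, nth 0 t d < nstates) ->
  [/\ forall x, x != 1 -> x != 2 -> regs s' x = regs s x,
      regs s' 1 = (regs s 1).+1 /\ regs s' 2 = regs s 2 - 3,
      forall j, Defs.mem s' 1 j = (if j == regs s 1 then i + m.1 else Defs.mem s 1 j) /\
                Defs.mem s' 2 j = (if j == regs s 1 then i + m.2 else Defs.mem s 2 j),
      (forall d, d < 4 -> Defs.mem s' 0 (i + d) = nth 0 l d) /\
      (forall j, j < i \/ i + 4 <= j -> Defs.mem s' 0 j = Defs.mem s 0 j)
    & (forall d, d < 3 -> Defs.mem s' 3 (i + d.+1) = nth 0 t d) /\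
      (forall j, j <= i \/ i + 4 <= j -> Defs.mem s' 3 j = Defs.mem s 3 j)].
Proof.
move=> s' hc ha m1 m2 hl ht.
have a0 : regs s 10 = i by rewrite -[RHS]addn0; exact: (ha 0).
have a1 : regs s 11 = i.+1 by rewrite -[i.+1]addn1; exact: (ha 1).
have a2 : regs s 12 = i.+2 by rewrite -[i.+2]addn2; exact: (ha 2).
have a3 : regs s 13 = i.+3 by rewrite -[i.+3]addn3; exact: (ha 3).
have cl d : regs s (cst (nth 0 l d)) = nth 0 l d by apply: hc.
have ct d : regs s (cst (nth 0 t d)) = nth 0 t d by apply: hc.
have am1 := ha m.1 (ltnW m1).
have am2 := ha m.2 (ltnW m2).
pose w0 := run (seqs ([seq Write 0 (10 + d) (cst (nth 0 l d)) | d <- iota 0 4]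
        ++ [seq Write 3 (11 + d) (cst (nth 0 t d)) | d <- iota 0 3])) s.
have r0 : regs w0 = regs s by [].
have m0 b j : Defs.mem w0 b j =
  if b == 3 then if j == i.+3 then nth 0 t 2 else if j == i.+2 then nth 0 t 1 else
                 if j == i.+1 then nth 0 t 0 else Defs.mem s b j
  else if b == 0 then
                 if j == i.+3 then nth 0 l 3 else if j == i.+2 then nth 0 l 2 else
                 if j == i.+1 then nth 0 l 1 else if j == i then nth 0 l 0 else Defs.mem s b j
  else Defs.mem s b j.
  rewrite /w0 /= a0 a1 a2 a3 !cl !ct.
  by case: (b =P 3) => [->|_] //=; case: (b =P 0) => [->|_].
have es : s' = run (seqs [:: Write 1 1 (10 + m.1); Write 2 1 (10 + m.2); Inc 1;
               Dec 2; Dec 2; Dec 2]) w0.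
  by rewrite -run_seqs_cat -catA.
clearbody s' w0; rewrite {}es.
rewrite /= r0 am1 am2; split.
- by move=> x x1 x2; rewrite (negbTE x1) (negbTE x2).
- by split=> //; lia.
- by move=> j; rewrite m0 m0 /=; case: (j == _).
- split=> [[|[|[|[|]]]] //= _ | j hj] //=; rewrite m0 /=.
  + by rewrite addn0; do 3![rewrite ifF; last by lia]; rewrite eqxx.
  + by rewrite addn1; do 2![rewrite ifF; last by lia]; rewrite eqxx.
  + by rewrite addn2; do 1![rewrite ifF; last by lia]; rewrite eqxx.
  + by rewrite addn3 eqxx.
  by do 4![rewrite ifF; last by lia].
split=> [[|[|[|]]] //= _ | j hj] //=; rewrite m0 /=.
- by rewrite addn1; do 2![rewrite ifF; last by lia]; rewrite eqxx.
- by rewrite addn2; do 1![rewrite ifF; last by lia]; rewrite eqxx.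
- by rewrite addn3 eqxx.
by do 3![rewrite ifF; last by lia].
Qed.

Lemma play_rcons ms m w u v : play ms w u -> hop m u v -> play (rcons ms m) w v.
Proof.
elim=> [{}w | m' {}ms {}w w1 w2 h _ IH] hv; first by apply: play_cons hv (play_nil _).
exact: play_cons h (IH hv).
Qed.

(** At the end no window is reducible, so the path costs as much as there are pegs, and the bound
    [total] becomes a bound on the pegs left. *)
Definition rw_inv (w : word) (total : nat) (s : state) : Prop :=
  let A := Defs.mem s 0 in let q := Defs.mem s 3 in
  exists u,
  [/\ size u = size w /\ play (output s) w u,
      [/\ has_consts nstates s, regs s 3 = (size w).+1 & regs s 9 = regs s 2 + 3],
      forall j, j <= size w -> A j = nth 0 (tape u) j,
      [/\ q 0 = stuck, q (size w).+1 = final,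
          forall j, j <= size w -> q j.+1 \in delta (q j) (A j)
        & \sum_(0 <= j < (size w).+1) cost (q j) (A j) <= total]
    & forall i, i < regs s 2 -> i + 4 <= (size w).+1 ->
        rewrites (window A q i) (q (i + 4)) = [::]].

(** A hop removes a peg and moves the cursor back by at most 3: windows further to
    the left are unaffected by the hop and remain irreducible. *)
Definition rw_measure (w : word) (s : state) : nat :=
  4 * (\sum_(0 <= j < (size w).+1) (Defs.mem s 0 j == 1)) + ((size w).+1 - regs s 2).

(** The decision tree has [nstates ^ 9] leaves; it is resolved symbolically to the branch of the
    current window and never unfolded. *)
Lemma run_rewrite_body s A q :
  has_consts nstates s -> Defs.mem s 0 = A -> Defs.mem s 3 = q ->
  (forall d, d < 5 -> q (regs s 2 + d) < nstates) ->
  (forall d, d < 4 -> A (regs s 2 + d) < nstates) ->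
  run rewrite_body s = run (seqs [:: Copy 9 2; Inc 9; Inc 9; Inc 9])
    (run (match rewrites (window A q (regs s 2)) (q (regs s 2 + 4)) with
          | [::] => Inc 2
          | (m, l, t) :: _ => write_rewrite m l t
          end) (run load_window s)).
Proof.
move=> hc eA eq hq hA.
have [m1 r1 a1 w1] := run_load_window s.
have c1 : has_consts nstates (run load_window s).
  by move=> k hk; rewrite r1 ?hc //; right; rewrite /cst; lia.
have h : all (fun x => regs (run load_window s) x < nstates) window_regs.
  rewrite -(all_map (regs (run load_window s)) (fun v => v < nstates)) w1 eA eq /=.
  have := hq 0 isT; have := hq 1 isT; have := hq 2 isT; have := hq 3 isT.
  have := hq 4 isT; have := hA 0 isT; have := hA 1 isT; have := hA 2 isT.
  have := hA 3 isT; rewrite !addn0 !addn1 !addn2 !addn3 !addn4.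
  by do 9![move=> ->].
rewrite /rewrite_body !(run_seqs_cons load_window) (run_seqs_cons (switches _ _ _)).
by rewrite (run_switches _ c1 h) w1 eA eq addn4.
Qed.

Lemma rw_step w total s : rw_inv w total s -> eval (Lt 9 3) s ->
  rw_inv w total (run rewrite_body s) /\
  rw_measure w (run rewrite_body s) < rw_measure w s.
Proof.
case=> u [[su pl] [hc r3 r9] Au [q0 qN path sum] irr].
rewrite /eval r3 r9 => hi.
have eA : Defs.mem s 0 = Defs.mem s 0 by [].
have eq : Defs.mem s 3 = Defs.mem s 3 by [].
have hq j : j <= (size w).+1 -> Defs.mem s 3 j < nstates.
  by case: j => [|j] hj; [rewrite q0 | exact: delta_lt (path j hj)].
have hA j : j <= size w -> Defs.mem s 0 j <= 2 by move=> hj; rewrite Au // tape_le2.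
have hq5 d : d < 5 -> Defs.mem s 3 (regs s 2 + d) < nstates by move=> hd; apply: hq; lia.
have hA4 d : d < 4 -> Defs.mem s 0 (regs s 2 + d) <= 2 by move=> hd; apply: hA; lia.
have hA4' d : d < 4 -> Defs.mem s 0 (regs s 2 + d) < nstates.
  by move=> hd; apply: leq_ltn_trans (hA4 d hd) _.
have := run_rewrite_body hc eA eq hq5 hA4'.
have [m1 r1 a1 _] := run_load_window s.
have c1 : has_consts nstates (run load_window s).
  by move=> k hk; rewrite r1 ?hc //; right; rewrite /cst; lia.
move: (run rewrite_body s) (run load_window s) m1 r1 a1 c1 => s' s1 m1 r1 a1 c1 {eA eq}.
have r12 : regs s1 2 = regs s 2 by apply: r1; left.
have r11 : regs s1 1 = regs s 1 by apply: r1; left.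
have r13 : regs s1 3 = (size w).+1 by rewrite r1 //; left.
case e: (rewrites _ _) => [|[[m l] t] rs] ->.
  set s2 := run _ s1.
  have r2 x : x != 2 -> regs s2 x = regs s1 x by rewrite /s2 /= => /negbTE ->.
  have r22 : regs s2 2 = (regs s 2).+1 by rewrite /s2 /= r12.
  have m2 : Defs.mem s2 = Defs.mem s by rewrite /s2 /= m1.
  clearbody s2; set s3 := run _ s2.
  have r3' x : x != 9 -> regs s3 x = regs s2 x by rewrite /s3 /= => /negbTE ->.
  have r39 : regs s3 9 = regs s2 2 + 3 by rewrite /s3 /= addn3.
  have m3 : Defs.mem s3 = Defs.mem s by rewrite -m2.
  clearbody s3; rewrite /rw_measure /rw_inv /output r39 (r3' 1) // (r3' 2) //.
  rewrite (r3' 3) // r22 (r2 1) // (r2 3) // r11 r13 m3.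
  split; last by lia.
  exists u; split=> //.
    split=> //.
    by move=> k hk; rewrite r3' // r2 // c1.
  by move=> i; rewrite ltnS leq_eqVlt => /orP [/eqP -> _ | /irr].
have er : (m, l, t) \in rewrites (window (Defs.mem s 0) (Defs.mem s 3) (regs s 2))
                                 (Defs.mem s 3 (regs s 2 + 4)).
  by rewrite e mem_head.
have [m14 m24 sl st] := rewrites_small hA4 er.
have := @run_write_rewrite s1 (regs s 2) m l t c1 a1 m14 m24 sl st.
move: (run _ s1) => s2 [r2 [r21 r22] m12 [A2 A2'] [q2 q2']].
rewrite m1 in m12 A2' q2'.
set s3 := run _ s2.
have r3' x : x != 9 -> regs s3 x = regs s2 x by rewrite /s3 /= => /negbTE ->.
have r39 : regs s3 9 = regs s2 2 + 3 by rewrite /s3 /= addn3.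
have m3 : Defs.mem s3 = Defs.mem s2 by [].
clearbody s3.
have Auu : forall j, j <= size u -> Defs.mem s 0 j = nth 0 (tape u) j by rewrite su.
have pathu : forall j, j <= size u ->
    Defs.mem s 3 j.+1 \in delta (Defs.mem s 3 j) (Defs.mem s 0 j) by rewrite su.
have hiu : regs s 2 + 3 <= size u by rewrite su; lia.
have [v [hv Av pathv sumv]] := rewrite_step Auu pathu hiu er A2 A2' q2 q2'.
have sv : size v = size w by rewrite -(hop_size hv).
have mA : \sum_(0 <= j < (size w).+1) (Defs.mem s 0 j == 1) = pegs u.
  by rewrite -sum_tape su; apply: eq_big_nat => j /andP [_ hj]; rewrite Au.
have mA2 : \sum_(0 <= j < (size w).+1) (Defs.mem s2 0 j == 1) = pegs v.
  by rewrite -sum_tape sv; apply: eq_big_nat => j /andP [_ hj]; rewrite Av ?su.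
rewrite su in Av pathv sumv.
rewrite /rw_measure m3 mA mA2 (hop_pegs hv) (r3' 2) // r22 r12.
split; last by lia.
exists v; rewrite /output m3 r39 (r3' 1) // (r3' 2) // (r3' 3) // r22 r12 r21 r11; split.
- split=> //; rewrite mkseqS.
  have -> : mkseq (fun k => (Defs.mem s2 1 k, Defs.mem s2 2 k)) (regs s 1) = output s.
    apply/eq_in_map => k; rewrite mem_iota /= add0n => hk.
    by have [-> ->] := m12 k; rewrite r11 (ltn_eqF hk).
  by have [-> ->] := m12 (regs s 1); rewrite r11 eqxx; apply: play_rcons pl hv.
- split=> //.
    by move=> k hk; rewrite r3' // r2 // c1.
  by rewrite r2.
- by [].
- split=> //; last exact: leq_trans sum.
    by rewrite q2' //; left.
  by rewrite q2' //; right; lia.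
(* Here [i + 3 < regs s 2], so the letters and states of this window, including the end state at
   [i + 4], are untouched. *)
move=> i hi3 hi4.
have -> : window (Defs.mem s2 0) (Defs.mem s2 3) i = window (Defs.mem s 0) (Defs.mem s 3) i.
  apply/eq_in_map => k; rewrite mem_iota => hk.
  by rewrite q2' ?A2' //; left; lia.
by rewrite q2' ?irr //; [lia | left; lia].
Qed.

(** * Linear time and optimality *)

Lemma flat_seqs2 c1 c2 l :
  flat c1 -> flat c2 -> flat (seqs l) -> flat (seqs [:: c1, c2 & l]).
Proof. by move=> /= -> ->. Qed.

Lemma flat_init : flat init.
Proof. by vm_compute. Qed.

Lemma flat_dp_body : flat dp_body.
Proof. by vm_compute. Qed.

Lemma flat_walk_body : flat walk_body.
Proof. by vm_compute. Qed.

(** The tree is too large for [vm_compute], so an arbitrary leaf is treated instead. *)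
Lemma flat_rewrite_body : flat rewrite_body.
Proof.
have h : flat (switches window_regs nstates apply_rewrite).
  apply: flat_switches => l; rewrite /apply_rewrite.
  do 9![case: l => [|? l] //]; case: l => //.
  by case: rewrites => [|[[m l] t] rs].
exact (@flat_seqs2 load_window _ [:: Copy 9 2; Inc 9; Inc 9; Inc 9] isT h isT).
Qed.

Theorem theorem2 :
  exists (P : cmd) (C : nat), forall w : word,
  exists (t : nat) (s : state) (w' : word),
    [/\ exec P (input w) t s,
        t <= C * (size w).+1,
        play (output s) w w'
      & forall (ms : seq (nat * nat)) (w'' : word),
          play ms w w'' -> pegs w' <= pegs w''].
Proof.
exists solver.
(* Existentials hide the time bounds, so that the one of the huge tree is never evaluated. *)
have [[c1 h1] [c2 h2] [c3 h3] [c4 h4]] :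
  [/\ exists c, max_time init <= c, exists c, (max_time dp_body).+1 <= c,
      exists c, (max_time walk_body).+1 <= c
    & exists c, (max_time rewrite_body).+1 <= c] by split; eexists; exact: leqnn.
exists (c1 + c2 + c3 + 5 * c4 + 10) => w.
have [t1 e1 b1] := exec_run (input w) flat_init.
have [fr1 i1 fin1] := run_init w.
move: (run init _) e1 fr1 i1 fin1 => s1 e1 fr1 i1 fin1.
have inv1 : dp_inv w s1.
  split=> //; first by rewrite i1.
  by move=> p j hp; rewrite i1; lia.
have [t2 [s2 [e2 b2 [fr2 _ fin2 rec2] done2]]] :=
  exec_while flat_dp_body inv1 (@dp_step w).
have [hc2 _ r23 A2] := fr2.
have i2 : regs s2 2 = 0 by move: done2; rewrite /eval hc2 // -leqNgt leqn0 => /eqP.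
pose D p j := Defs.mem s2 (cost_arr p) j; pose B p j := Defs.mem s2 (next_arr p) j.
have dp : dp_table w D B (size w).+1.
  split=> [p hp|p j hp hj]; first exact: fin2.
  by apply: rec2 => //; rewrite i2.
have stuck_lt : stuck < nstates by [].
(* Single pegs give a path of cost at most [size w], so the least cost lies below the infinite
   one. *)
have D0 : D stuck 0 < (size w).+1.
  rewrite ltnS; apply: leq_trans (count_size id w).
  exact: (dp_reach dp stuck_lt (reach_singles w (leqnn 1))).
have [qN path sum] := dp_walk dp D0 (erefl : walk B 0 = stuck) (fun j _ => erefl).
have wB j : j <= size w -> walk B j < nstates.
  by case: j => [//|j] hj; apply: delta_lt (path j (ltnW hj)).
pose s3 := run (seqs [:: Const 2 0; Write 3 2 (cst stuck)]) s2.
have inv3 : walk_inv w B s3.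
  split=> //.
  by move=> j; rewrite leqn0 => /eqP ->; exact: (hc2 1).
have [t4 [s4 [e4 b4 [fr4 i4 next4 st4] done4]]] :=
  exec_while flat_walk_body inv3 (fun s => @walk_step w B s wB).
have [hc4 r41 r43 A4] := fr4.
have {}i4 : regs s4 2 = (size w).+1.
  by move: done4; rewrite /eval r43 -leqNgt => h; apply/eqP; rewrite eqn_leq i4.
pose s5 := run (seqs [:: Const 2 0; Const 9 3]) s4.
have r5 x : x != 2 -> x != 9 -> regs s5 x = regs s4 x.
  by move=> /negbTE x2 /negbTE x9; rewrite /s5 /= x2 x9.
have inv5 : rw_inv w (D stuck 0) s5.
  have q4 j : j <= (size w).+1 -> Defs.mem s5 3 j = walk B j.
    by move=> hj; apply: st4; rewrite i4.
  exists w; split=> //.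
  - by split=> //; rewrite /output r5 // r41; exact: play_nil.
  split; [exact: (q4 0) | by rewrite -qN; exact: q4 | |].
    move=> j hj; rewrite !q4 //; last exact: ltnW.
    by rewrite (A4 j hj); apply: path.
  rewrite -sum leq_eqVlt; apply/orP; left; apply/eqP.
  by apply: eq_big_nat => j /andP [_ hj]; rewrite (A4 j hj) q4 // ltnW.
have [t6 [s6 [e6 b6 [u [[su pl] [hc6 r63 r69] Au [q0 qN6 path6 sum6] irr]] done6]]] :=
  exec_while flat_rewrite_body inv5 (@rw_step w (D stuck 0)).
exists (t1 + (t2 + (1 + (1 + (t4 + (1 + (1 + (t6 + 1)))))))), s6, u; split=> //.
- apply: exec_seq e1 (exec_seq e2 _).
  apply: exec_seq (exec_const _ _ _) (exec_seq (exec_write _ _ _ _) _).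
  apply: exec_seq e4 (exec_seq (exec_const _ _ _) (exec_seq (exec_const _ _ _) _)).
  exact: exec_seq e6 (exec_skip _).
(* The cursor starts at 0 and there are at most [size w] pegs, whence the factor 5 on [c4]. *)
- have m5 : rw_measure w s5 <= 5 * (size w).+1.
    rewrite /rw_measure /= subn0.
    have : \sum_(0 <= j < (size w).+1) (Defs.mem s4 0 j == 1) <= (size w).+1.
      have -> : \sum_(0 <= j < (size w).+1) (Defs.mem s4 0 j == 1) = pegs w.
        by rewrite -sum_tape; apply: eq_big_nat => j /andP [_ hj]; rewrite A4.
      by apply: leqW; apply: count_size.
    by lia.
  rewrite i1 in b2; have z3 : regs s3 2 = 0 by [].
  rewrite z3 subn0 in b4.
  move: (leq_trans b1 h1)
        (leq_trans b2 (leq_add (leq_mul h2 (leqnn (size w).+1)) (leqnn 1)))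
        (leq_trans b4 (leq_add (leq_mul h3 (leqnn (size w).+1)) (leqnn 1)))
        (leq_trans b6 (leq_add (leq_mul h4 m5) (leqnn 1))).
  clear; nia.
(* The pegs of [u] equal the cost of the final path, which is at most [D stuck 0], hence at most the
   cost [d] of any path over [w], hence at most [pegs w'']. *)
move=> ms w'' /play_reach [d hd dw]; apply: leq_trans dw.
apply: leq_trans (dp_reach dp stuck_lt hd); apply: leq_trans sum6.
rewrite -sum_tape su leq_eqVlt; apply/orP; left; apply/eqP.
apply: eq_big_nat => j /andP [_ hj]; rewrite -Au //.
rewrite (@irreducible_cost (Defs.mem s6 0) (Defs.mem s6 3) (size w).+1) //.
(* On exit the cursor is at least [size w - 2], so every full window starts to its left. *)
move=> i hi; apply: irr => //.
by move: done6; rewrite /eval r63 r69; lia.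
Qed.
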